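(* Let $n\ge 1$, $\alpha\in(\frac12,1)$, let $\mathbf v\in\mathbb R^n$ with $\mathbf v\ge 0$ and $\mathbf 1_n^\top \mathbf v=1$, and let $R\in\mathbb R^{n\times n^2}$ with $R\ge 0$ and $\mathbf 1_n^\top R=\mathbf 1_{n^2}^\top$. Let $\mathbf m$ be the minimal nonnegative solution of $$\mathbf x=\alpha R(\mathbf x\otimes\mathbf x)+(1-\alpha)\mathbf v,$$ and assume that $\mathbf m>0$ and that the matrix $\alpha R(\mathbf m\otimes I_n)+\alpha R(I_n\otimes\mathbf m)$ is irreducible. Let $\mathbf s$ be a stochastic solution of this equation and suppose that $I_n-G'_{\mathbf s}$ is nonsingular, where $G'_{\mathbf s}=\alpha R(\mathbf s\otimes I_n)+\alpha R(I_n\otimes\mathbf s)$. Then, for all $\hat\alpha$ in a neighbourhood of $\alpha$, there is a stochastic solution $\mathbf s_{\hat\alpha}$ of $\mathbf x=\hat\alpha R(\mathbf x\otimes\mathbf x)+(1-\hat\alpha)\mathbf v$ such that, as $\hat\alpha\to\alpha$, $$\mathbf s_{\hat\alpha}=\mathbf s+\mathbf s^{(1)}(\hat\alpha-\alpha)+\tfrac12\mathbf s^{(2)}(\hat\alpha-\alpha)^2+O\bigl((\hat\alpha-\alpha)^3\bigr),$$ where $$\mathbf s^{(1)}=(I_n-G'_{\mathbf s})^{-1}\bigl(R(\mathbf s\otimes\mathbf s)-\mathbf v\bigr),\qquad \mathbf s^{(2)}=(I_n-G'_{\mathbf s})^{-1}R\bigl(\mathbf t\otimes\mathbf s^{(1)}+\mathbf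 s^{(1)}\otimes\mathbf t\bigr),\qquad \mathbf t=2\mathbf s+\alpha\mathbf s^{(1)}.$$
   Context: $\mathbf 1_k$ denotes the column vector of all ones of length $k$; inequalities between vectors and matrices are componentwise; $\otimes$ is the Kronecker product. A vector $\mathbf s\in\mathbb R^n$ is stochastic if $\mathbf s\ge 0$ and $\mathbf 1_n^\top\mathbf s=1$. The minimal nonnegative solution is the (always existing, unique) solution $\mathbf m\ge 0$ such that $\mathbf m\le\mathbf x$ for every solution $\mathbf x\ge 0$. *)

(* Defs.v *)
(* MathComp with MathComp-Analysis; [*t] (tensmx) is the Kronecker product. *)
From HB Require Import structures.
From mathcomp Require Export all_boot all_order all_fingroup all_algebra.
From mathcomp Require Export all_classical all_reals all_analysis.
From mathcomp Require Export mxtens.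

Set Implicit Arguments.
Unset Strict Implicit.
Unset Printing Implicit Defensive.

Export Order.TTheory GRing.Theory Num.Theory.
Export numFieldNormedType.Exports.

#[global] Open Scope classical_set_scope.
#[global] Open Scope ring_scope.

Definition mx_nonneg (K : realType) (m n : nat) (A : 'M[K]_(m, n)) : Prop :=
  forall i j, 0 <= A i j.

Definition mx_positive (K : realType) (m n : nat) (A : 'M[K]_(m, n)) : Prop :=
  forall i j, 0 < A i j.

Definition mx_le (K : realType) (m n : nat) (A B : 'M[K]_(m, n)) : Prop :=
  forall i j, A i j <= B i j.

Definition ones (K : realType) (k : nat) : 'cV[K]_k := const_mx 1.
Arguments ones {K} k.

Definition stochastic (K : realType) (n : nat) (x : 'cV[K]_n) : Prop :=
  mx_nonneg x /\ (ones n)^T *m x = 1%:M.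

(* A is reducible when P A P^T = [[A11, A12], [0, A22]] for some permutation
   matrix P, with square diagonal blocks of orders k and n - k, 0 < k < n. *)
Definition mx_reducible (K : realType) (n : nat) (A : 'M[K]_n) : Prop :=
  exists (p : 'S_n) (k : nat), (0 < k < n)%N /\
    forall i j : 'I_n, (k <= i)%N -> (j < k)%N ->
      (perm_mx p *m A *m (perm_mx p)^T) i j = 0.

Definition mx_irreducible (K : realType) (n : nat) (A : 'M[K]_n) : Prop :=
  ~ mx_reducible A.

(* [tensmx] yields ['cV_(m * n)] only up to the conversion [1 * 1 = 1]. *)
Definition kron_vec (K : realType) (m n : nat) (x : 'cV[K]_m) (y : 'cV[K]_n) :
  'cV[K]_(m * n) := x *t y.

(* The casts only identify the column dimensions [1 * n] and [n * 1] with
   [n]. *)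
Definition kron_vec_id (K : realType) (n : nat) (x : 'cV[K]_n) :
  'M[K]_(n * n, n) := castmx (erefl, mul1n n) (x *t (1%:M : 'M[K]_n)).

Definition kron_id_vec (K : realType) (n : nat) (x : 'cV[K]_n) :
  'M[K]_(n * n, n) := castmx (erefl, muln1 n) ((1%:M : 'M[K]_n) *t x).

Definition is_solution (K : realType) (n : nat) (R : 'M[K]_(n, n * n))
    (v : 'cV[K]_n) (a : K) (x : 'cV[K]_n) : Prop :=
  x = a *: (R *m kron_vec x x) + (1 - a) *: v.

Definition is_minimal_nonneg_solution (K : realType) (n : nat)
    (R : 'M[K]_(n, n * n)) (v : 'cV[K]_n) (a : K) (m : 'cV[K]_n) : Prop :=
  [/\ is_solution R v a m, mx_nonneg m &
      forall x, is_solution R v a x -> mx_nonneg x -> mx_le m x].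

Definition Gprime (K : realType) (n : nat) (R : 'M[K]_(n, n * n)) (a : K)
    (x : 'cV[K]_n) : 'M[K]_n :=
  a *: (R *m kron_vec_id x) + a *: (R *m kron_id_vec x).

Definition expansion_coef1 (K : realType) (n : nat) (R : 'M[K]_(n, n * n))
    (v : 'cV[K]_n) (a : K) (s : 'cV[K]_n) : 'cV[K]_n :=
  invmx (1%:M - Gprime R a s) *m (R *m kron_vec s s - v).

Definition expansion_coef2 (K : realType) (n : nat) (R : 'M[K]_(n, n * n))
    (v : 'cV[K]_n) (a : K) (s : 'cV[K]_n) : 'cV[K]_n :=
  let s1 := expansion_coef1 R v a s in
  let t := 2 *: s + a *: s1 in
  invmx (1%:M - Gprime R a s) *m (R *m (kron_vec t s1 + kron_vec s1 t)).

(* Main.v *)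
From HB Require Import structures.
Require Import Defs.
From mathcomp Require Import ring lra.

(** Let B(x, y) be R times the Kronecker product of x and y, h = a - alpha and
    M = I - G'_s.  Existence of the branch and its expansion come out of one fixed-point argument, without
    the implicit function theorem.  Let p(h) = s + h s1 + h^2/2 s2.  The linear
    equations defining s1 and s2 say exactly that p(h) solves the equation with
    parameter alpha + h up to terms of order h^3.  Substituting
    x = p(h) + h^3 z and dividing by h^3 therefore leaves an equation

      M z = c(h) + h g_h(z)

    where c(h) is polynomial in h ([residual]) and g_h is quadratic in z
    ([coupling]; the identity is [solution_of_scaled_remainder]).  Since M is
    invertible and g_h is Lipschitz on balls uniformly in |h| <= 1, the map
    z |-> M^-1 (c(h) + h g_h(z)) is a contraction of a fixed ball once h is
    small.  Its fixed point gives a solution within O(h^3) of p(h)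
    ([solution_branch]).

    It remains to see that these solutions are stochastic, for which it is
    enough that they converge to s ([near_stochastic]).  Summing the entries of
    the equation shows that the entry sum sigma of any solution satisfies
    (sigma - 1) (a (sigma + 1) - 1) = 0.  At (alpha, s) the second factor is
    2 alpha - 1 > 0, so it does not vanish nearby and sigma = 1.  Moreover
    s >= m > 0 by minimality of m, so vectors close to s are positive. *)

Set Implicit Arguments.
Unset Strict Implicit.
Unset Printing Implicit Defensive.

(** * A fixed point in a ball *)

(** Banach's theorem needs matrices both as a normed module and as a complete
    space; this joins the two existing structures. *)
HB.instance Definition _ (K : realType) m n := Complete.on 'M[K]_(m, n).

(** The bound on [f 0] is what keeps the ball stable: the image of a point of
    the ball is at most r/2 away from [f 0]. *)
Lemma half_lipschitz_fixed_point (K : realType) (V : completeNormedModType K)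
    (f : V -> V) (r : K) :
  0 <= r -> `|f 0| <= r / 2 ->
  (forall z w, `|z| <= r -> `|w| <= r -> `|f z - f w| <= `|z - w| / 2) ->
  exists2 z, `|z| <= r & z = f z.
Proof.
move=> r0 f0 fL; pose U := [set z : V | `|z| <= r].
have fU : set_fun U U f.
  move=> z /= zr; rewrite /U/= -[f z](subrK (f 0)) (le_trans (ler_normD _ _))//.
  rewrite [leRHS](splitr r) lerD//.
  by rewrite (le_trans (fL _ _ _ _)) ?normr0// subr0 ler_pM2r ?invr_gt0.
pose F : {fun U >-> U} := HB.pack f (isFun.Build _ _ U U f fU).
have ctrF : is_contraction F.
  exists (2^-1)%:nng; split => /=; first by rewrite invf_lt1 ?ltr1n.
  by move=> [z w] [/= zr wr]; rewrite mulrC; exact: fL.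
have Ucl : closed U.
  have := @preimage_closed V K (fun z => `|z|) [set x : K | x <= r].
  by apply; [move=> z _; exact: norm_continuous|exact: closed_le].
have [|z zr zf] := banach_fixed_point ctrF Ucl; last by exists z.
by exists 0; rewrite /U/= normr0.
Qed.

(** * Bounds for the entrywise maximum norm *)

Lemma mx_norm_leP (K : realType) m n (A : 'M[K]_(m, n)) (e : K) : 0 <= e ->
  reflect (forall i j, `|A i j| <= e) (`|A| <= e).
Proof.
move=> e0; rewrite [`|A|]/Num.norm/= mx_normrE; apply: (iffP idP) => [|Ae].
  by move=> /bigmax_leP[_ Ae] i j; exact: (Ae (i, j) isT).
by apply/bigmax_leP; split=> // -[i j] _; exact: Ae.
Qed.

Lemma ler_coord_norm (K : realType) m n (A : 'M[K]_(m, n)) i j :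
  `|A i j| <= `|A|.
Proof. by have /(mx_norm_leP _ (normr_ge0 A)) := lexx (`|A|). Qed.

Lemma ler_norm_mulmx (K : realType) m n p (A : 'M[K]_(m, n)) (B : 'M[K]_(n, p)) :
  `|A *m B| <= n%:R * `|A| * `|B|.
Proof.
apply/mx_norm_leP => [|i j]; first by rewrite !mulr_ge0.
rewrite mxE (le_trans (ler_norm_sum _ _ _))//.
rewrite -mulrA mulr_natl -[X in _ *+ X]card_ord -sumr_const ler_sum// => k _.
by rewrite normrM ler_pM// ler_coord_norm.
Qed.

Lemma ler_norm_tensmx (K : realType) m n p q (A : 'M[K]_(m, n))
    (B : 'M[K]_(p, q)) :
  `|A *t B| <= `|A| * `|B|.
Proof.
apply/mx_norm_leP => [|i j]; first by rewrite mulr_ge0.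
by rewrite mxE normrM ler_pM// ler_coord_norm.
Qed.

(** * The bilinear map of the equation *)

Lemma kron_vecE (K : realType) m n (x : 'cV[K]_m) (y : 'cV[K]_n) i j :
  kron_vec x y (mxtens_index (i, j)) 0 = x i 0 * y j 0.
Proof. by rewrite !mxE mxtens_indexK !ord1. Qed.

Lemma kron_vec_idE (K : realType) n (x : 'cV[K]_n) i j k :
  kron_vec_id x (mxtens_index (i, j)) k = x i 0 * (j == k)%:R.
Proof.
rewrite castmxE cast_ord_id mxE mxtens_indexK mxE ord1; congr (_ * (_ == _)%:R).
by apply: val_inj => /=; rewrite modn_small.
Qed.

Lemma kron_id_vecE (K : realType) n (x : 'cV[K]_n) i j k :
  kron_id_vec x (mxtens_index (i, j)) k = (i == k)%:R * x j 0.
Proof.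
rewrite castmxE cast_ord_id mxE mxtens_indexK mxE ord1; congr ((_ == _)%:R * _).
by apply: val_inj => /=; rewrite divn1.
Qed.

Lemma mul_kron_vec_id (K : realType) n (x z : 'cV[K]_n) :
  kron_vec_id x *m z = kron_vec x z.
Proof.
apply/matrixP=> i j; rewrite (ord1 j) mxE; case: (mxtens_indexP i) => i1 i2.
rewrite kron_vecE (bigD1 i2)//= big1 ?addr0 => [|k]; rewrite kron_vec_idE.
  by rewrite eqxx mulr1.
by rewrite eq_sym => /negPf->; rewrite mulr0 mul0r.
Qed.

Lemma mul_kron_id_vec (K : realType) n (x z : 'cV[K]_n) :
  kron_id_vec x *m z = kron_vec z x.
Proof.
apply/matrixP=> i j; rewrite (ord1 j) mxE; case: (mxtens_indexP i) => i1 i2.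
rewrite kron_vecE (bigD1 i1)//= big1 ?addr0 => [|k]; rewrite kron_id_vecE.
  by rewrite eqxx mul1r mulrC.
by rewrite eq_sym => /negPf->; rewrite !mul0r.
Qed.

Section bilinear.
Variables (K : realType) (n : nat) (R : 'M[K]_(n, n * n)).
Implicit Types x y z : 'cV[K]_n.

Definition bil x y : 'cV[K]_n := R *m kron_vec x y.

Lemma bilDl x y z : bil (x + y) z = bil x z + bil y z.
Proof.
rewrite /bil -mulmxDr; congr (_ *m _).
by apply/matrixP=> i j; rewrite !mxE mulrDl.
Qed.

Lemma bilDr x y z : bil z (x + y) = bil z x + bil z y.
Proof.
rewrite /bil -mulmxDr; congr (_ *m _).
by apply/matrixP=> i j; rewrite !mxE mulrDr.
Qed.

Lemma bilZl a x y : bil (a *: x) y = a *: bil x y.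
Proof.
rewrite /bil scalemxAr; congr (_ *m _).
by apply/matrixP=> i j; rewrite !mxE mulrA.
Qed.

Lemma bilZr a x y : bil x (a *: y) = a *: bil x y.
Proof.
rewrite /bil scalemxAr; congr (_ *m _).
by apply/matrixP=> i j; rewrite !mxE mulrCA.
Qed.

Lemma bil0l x : bil 0 x = 0.
Proof. by rewrite -[X in bil X _](scale0r 0) bilZl scale0r. Qed.

Lemma bil0r x : bil x 0 = 0.
Proof. by rewrite -[X in bil _ X](scale0r 0) bilZr scale0r. Qed.

Definition bil_norm : K := (n * n)%:R * `|R|.

Lemma ler_bil x y : `|bil x y| <= bil_norm * (`|x| * `|y|).
Proof.
apply: le_trans (ler_norm_mulmx _ _) _.
by apply: ler_wpM2l; [rewrite mulr_ge0|exact: (@ler_norm_tensmx K n 1 n 1 x y)].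
Qed.

(** [Gprime R a x] is the derivative at [x] of the quadratic part
    a B(x, x). *)
Lemma Gprime_mul a x z : Gprime R a x *m z = a *: (bil x z + bil z x).
Proof.
rewrite /Gprime mulmxDl -!scalemxAl -scalerDr -!mulmxA.
by rewrite mul_kron_vec_id mul_kron_id_vec.
Qed.

End bilinear.

(** * The equation for the scaled remainder *)

(** Let p = s + h s1 + (h^2/2) s2.  This is what remains, after division by
    h^3, of (alpha + h) B(p, p) + (1 - alpha - h) v - p: the coefficients of
    h^3, h^4 and h^5 in that polynomial, the lower ones being zero by the
    choice of s1 and s2. *)
Definition residual (K : realType) n (R : 'M[K]_(n, n * n)) (alpha : K)
    (s s1 s2 : 'cV[K]_n) (h : K) : 'cV[K]_n :=
  bil R s1 s1 + (alpha / 2) *: (bil R s1 s2 + bil R s2 s1)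
    + 2^-1 *: (bil R s s2 + bil R s2 s)
    + h *: ((alpha / 4) *: bil R s2 s2 + 2^-1 *: (bil R s1 s2 + bil R s2 s1))
    + h ^+ 2 *: (4^-1 *: bil R s2 s2).

(** For h nonzero this is ((alpha + h) x - alpha s) / h with
    x = s + h s1 + (h^2/2) s2 + h^3 z, written so that it makes sense at
    h = 0. *)
Definition coupling_arg (K : realType) n (alpha : K) (s s1 s2 : 'cV[K]_n)
    (h : K) (z : 'cV[K]_n) : 'cV[K]_n :=
  s + (alpha + h) *: (s1 + (h / 2) *: s2) + ((alpha + h) * h ^+ 2) *: z.

(** With a = alpha + h and x = p + h^3 z, this is the z-dependent part of
    a B(x, x) - alpha (B(s, h^3 z) + B(h^3 z, s)) divided by h^4: the linear
    part at s belongs to [1%:M - Gprime R alpha s], and the term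
    a B(h^3 z, h^3 z) is absorbed in the second summand. *)
Definition coupling (K : realType) n (R : 'M[K]_(n, n * n)) (alpha : K)
    (s s1 s2 : 'cV[K]_n) (h : K) (z : 'cV[K]_n) : 'cV[K]_n :=
  let u := coupling_arg alpha s s1 s2 h in bil R (u 0) z + bil R z (u z).

(** The factorization of B(z, z) - B(w, w) for a bilinear B, which gives the
    Lipschitz estimate. *)
Lemma couplingB (K : realType) n (R : 'M[K]_(n, n * n)) alpha s s1 s2 h z w :
  let u := coupling_arg alpha s s1 s2 h in
  coupling R alpha s s1 s2 h z - coupling R alpha s s1 s2 h w =
  bil R (u w) (z - w) + bil R (z - w) (u z).
Proof.
rewrite /coupling /coupling_arg /= scaler0 addr0 -![- w]scaleN1r.
rewrite !(bilDl, bilDr, bilZl, bilZr).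
by move: (bil R) => B; apply/matrixP => i j; rewrite !mxE; ring.
Qed.

(** Comparing powers of h: the defect of the candidate solution is the equation
    for s, plus h times the one for s1, plus h^2/2 times the one for s2, plus
    h^3 times the one for z. *)
Lemma solution_of_scaled_remainder (K : realType) n (R : 'M[K]_(n, n * n))
    (v s s1 s2 : 'cV[K]_n) (alpha h : K) (z : 'cV[K]_n) :
  is_solution R v alpha s ->
  (1%:M - Gprime R alpha s) *m s1 = bil R s s - v ->
  (1%:M - Gprime R alpha s) *m s2 =
    2 *: (bil R s s1 + bil R s1 s) + (2 * alpha) *: bil R s1 s1 ->
  (1%:M - Gprime R alpha s) *m z =
    residual R alpha s s1 s2 h + h *: coupling R alpha s s1 s2 h z ->
  is_solution R v (alpha + h)
    (s + h *: s1 + (1 / 2 * h ^+ 2) *: s2 + h ^+ 3 *: z).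
Proof.
rewrite !mulmxBl !mul1mx !Gprime_mul /residual /coupling /coupling_arg /= scaler0 addr0.
rewrite /is_solution -!/(bil _ _ _).
rewrite !(bilDl, bilDr, bilZl, bilZr).
move: (bil R) => B /matrixP E0 /matrixP E1 /matrixP E2 /matrixP E3.
apply/matrixP => i j; have := E3 i j; have := E2 i j; have := E1 i j; have := E0 i j.
rewrite !mxE => {}E0 {}E1 {}E2 {}E3.
(* With these weights the goal is linear in the entries and their products. *)
have {}E1 := congr1 (fun t => h * t) E1.
have {}E2 := congr1 (fun t => h ^+ 2 / 2 * t) E2.
have {}E3 := congr1 (fun t => h ^+ 3 * t) E3.
lra.
Qed.

Lemma expansion_coef1E (K : realType) n (R : 'M[K]_(n, n * n)) v alpha s :
  1%:M - Gprime R alpha s \in unitmx ->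
  (1%:M - Gprime R alpha s) *m expansion_coef1 R v alpha s = bil R s s - v.
Proof. by move=> Gs_unit; rewrite /expansion_coef1 mulKVmx. Qed.

Lemma expansion_coef2E (K : realType) n (R : 'M[K]_(n, n * n)) v alpha s :
  let s1 := expansion_coef1 R v alpha s in
  1%:M - Gprime R alpha s \in unitmx ->
  (1%:M - Gprime R alpha s) *m expansion_coef2 R v alpha s =
    2 *: (bil R s s1 + bil R s1 s) + (2 * alpha) *: bil R s1 s1.
Proof.
move=> s1 Gs_unit; rewrite /expansion_coef2 mulKVmx// mulmxDr -!/(bil _ _ _) -/s1.
rewrite !(bilDl, bilDr, bilZl, bilZr); move: (bil R) => B.
by apply/matrixP=> i j; rewrite !mxE; ring.
Qed.

(** * The solution branch through s *)

Lemma ler_norm_scaled (K : realType) (V : normedModType K) (a e : K) (x : V) :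
  `|a| <= e -> `|a *: x| <= e * `|x|.
Proof. by move=> ae; rewrite normrZ ler_wpM2r. Qed.

Lemma residual_bounded (K : realType) n (R : 'M[K]_(n, n * n)) alpha s s1 s2 :
  exists2 C, 0 <= C &
    forall h, `|h| <= 1 -> `|residual R alpha s s1 s2 h| <= C.
Proof.
rewrite /residual; set c0 := (_ + _ + 2^-1 *: _); set c1 := (_ *: _ + _).
set c2 := 4^-1 *: _; exists (`|c0| + `|c1| + `|c2|) => [|h h1].
  by rewrite !addr_ge0.
rewrite (le_trans (ler_normD _ _))// lerD//.
  rewrite (le_trans (ler_normD _ _))// lerD// -[leRHS]mul1r.
  exact: ler_norm_scaled.
by rewrite -[leRHS]mul1r ler_norm_scaled // normrX exprn_ile1.
Qed.

Lemma coupling_arg_bounded (K : realType) n alpha (s s1 s2 : 'cV[K]_n) r :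
  0 <= r ->
  exists2 U, 0 <= U & forall h z, `|h| <= 1 -> `|z| <= r ->
    `|coupling_arg alpha s s1 s2 h z| <= U.
Proof.
move=> r0; pose A := `|alpha| + 1.
have A0 : 0 <= A by rewrite addr_ge0.
exists (`|s| + A * (`|s1| + `|s2|) + A * r) => [|h z h1 zr].
  by rewrite !addr_ge0// mulr_ge0// addr_ge0.
have aA : `|alpha + h| <= A by rewrite (le_trans (ler_normD _ _))// lerD.
rewrite /coupling_arg (le_trans (ler_normD _ _))// lerD//.
  rewrite (le_trans (ler_normD _ _))// lerD//.
  rewrite (le_trans (ler_norm_scaled _ aA))// ler_wpM2l//.
  rewrite (le_trans (ler_normD _ _))// lerD// -[leRHS]mul1r ler_norm_scaled//.
  by rewrite normrM normfV (ger0_norm (ler0n _ 2)); lra.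
have ahA : `|(alpha + h) * h ^+ 2| <= A.
  by rewrite normrM -[leRHS]mulr1 ler_pM// normrX exprn_ile1.
by rewrite (le_trans (ler_norm_scaled _ ahA))// ler_wpM2l.
Qed.

Lemma coupling0 (K : realType) n (R : 'M[K]_(n, n * n)) alpha s s1 s2 h :
  coupling R alpha s s1 s2 h 0 = 0.
Proof. by rewrite /coupling bil0l bil0r addr0. Qed.

(** The constant must be uniform in h, so that the factor h in front of
    [coupling] makes the fixed-point map a contraction. *)
Lemma coupling_lipschitz (K : realType) n (R : 'M[K]_(n, n * n)) alpha s s1 s2
    r : 0 <= r ->
  exists2 L, 0 <= L & forall h z w, `|h| <= 1 -> `|z| <= r -> `|w| <= r ->
    `|coupling R alpha s s1 s2 h z - coupling R alpha s s1 s2 h w|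
      <= L * `|z - w|.
Proof.
move=> r0; have [U U0 Ubound] := coupling_arg_bounded alpha s s1 s2 r0.
have b0 : 0 <= bil_norm R by rewrite /bil_norm mulr_ge0.
exists (bil_norm R * U + bil_norm R * U) => [|h z w h1 zr wr].
  by rewrite addr_ge0 ?mulr_ge0.
rewrite couplingB mulrDl (le_trans (ler_normD _ _))// lerD//;
  rewrite (le_trans (ler_bil _ _ _))// -(mulrA (bil_norm R)) ler_wpM2l//.
- by rewrite ler_wpM2r ?Ubound.
- by rewrite mulrC ler_wpM2r ?Ubound.
Qed.

Definition taylor2 (K : realType) n (R : 'M[K]_(n, n * n)) v alpha s (a : K) :
    'cV[K]_n :=
  s + (a - alpha) *: expansion_coef1 R v alpha s
    + (1 / 2 * (a - alpha) ^+ 2) *: expansion_coef2 R v alpha s.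

(** The fixed point z stays in a ball whose radius r does not depend on a; this
    is the constant of the cubic error term. *)
Lemma solution_branch (K : realType) n (R : 'M[K]_(n, n * n)) v alpha s :
  is_solution R v alpha s -> 1%:M - Gprime R alpha s \in unitmx ->
  exists2 r, 0 <= r & \forall a \near alpha, exists2 x, is_solution R v a x &
    `|x - taylor2 R v alpha s a| <= r * `|(a - alpha) ^+ 3|.
Proof.
move=> s_sol Gs_unit; set M := 1%:M - _ in Gs_unit.
pose s1 := expansion_coef1 R v alpha s; pose s2 := expansion_coef2 R v alpha s.
have [C C0 Cbound] := residual_bounded R alpha s s1 s2.
pose k := n%:R * `|invmx M|; have k0 : 0 <= k by rewrite mulr_ge0.
(* Twice the norm bound of the image of 0 under the fixed-point map. *)
pose r := 2 * (k * C); have r0 : 0 <= r by rewrite !mulr_ge0.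
have [L L0 Lip] := coupling_lipschitz R alpha s s1 s2 r0.
have kL0 : 0 <= k * L by rewrite mulr_ge0.
exists r => //; have e0 : 0 < 1 + 2 * (k * L) by rewrite ltr_pwDl// mulr_ge0.
near=> a; pose h := a - alpha.
(* One smallness condition yields both |h| <= 1 and the contraction. *)
have he : `|h| * (1 + 2 * (k * L)) <= 1.
  rewrite -ler_pdivlMr// mul1r /h distrC ltW//; near: a.
  by apply: cvgr_dist_lt; rewrite ?invr_gt0//; exact: cvg_id.
have h1 : `|h| <= 1.
  by apply: le_trans he; rewrite ler_peMr// lerDl mulr_ge0.
have hL : `|h| * (k * L) <= 2^-1.
  by have := normr_ge0 h; move: he; rewrite mulrDr; lra.
pose f z := invmx M *m (residual R alpha s s1 s2 h
  + h *: coupling R alpha s s1 s2 h z).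
have [||z zr zE] := @half_lipschitz_fixed_point K 'cV[K]_n f r r0.
- have -> : r / 2 = k * C by rewrite /r; field.
  rewrite /f coupling0 scaler0 addr0 (le_trans (ler_norm_mulmx _ _))// ler_wpM2l//.
  exact: Cbound.
- move=> z w zr wr.
  rewrite /f -mulmxBr (le_trans (ler_norm_mulmx _ _))// -/k opprD addrACA subrr.
  rewrite add0r -scalerBr normrZ mulrCA.
  apply: (@le_trans _ _ (`|h| * (k * L) * `|z - w|)).
    by rewrite -!mulrA !ler_wpM2l// Lip.
  by rewrite mulrC ler_wpM2l.
exists (taylor2 R v alpha s a + h ^+ 3 *: z); last first.
  by rewrite addrC addKr normrZ mulrC ler_wpM2r.
have -> : a = alpha + h by rewrite /h addrC subrK.
rewrite /taylor2 (addrC alpha) addrK.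
rewrite (addrC h); apply: solution_of_scaled_remainder => //.
- exact: expansion_coef1E.
- exact: expansion_coef2E.
- by rewrite {1}zE /f mulKVmx.
Unshelve. all: by end_near. Qed.

(** * Solutions near s are stochastic *)

Lemma mul_ones_tr (K : realType) n (x : 'cV[K]_n) :
  (ones n)^T *m x = (\sum_i x i 0)%:M.
Proof.
rewrite [LHS]mx11_scalar mxE; congr (_%:M).
by apply: eq_bigr => i _; rewrite !mxE mul1r.
Qed.

Lemma stochasticP (K : realType) n (x : 'cV[K]_n) :
  stochastic x <-> mx_nonneg x /\ \sum_i x i 0 = 1.
Proof.
rewrite /stochastic mul_ones_tr; split=> -[x0 x1]; split=> //; last by rewrite x1.
by have := congr1 (fun A : 'M[K]_1 => A 0 0) x1; rewrite !mxE.
Qed.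

(** As the columns of R sum to 1, summing entries turns the Kronecker product
    into a product of scalars. *)
Lemma sum_bil (K : realType) n (R : 'M[K]_(n, n * n)) (x y : 'cV[K]_n) :
  (ones n)^T *m R = (ones (n * n))^T ->
  \sum_i bil R x y i 0 = (\sum_i x i 0) * (\sum_i y i 0).
Proof.
move=> Rsum; have := mul_ones_tr (bil R x y); rewrite /bil mulmxA Rsum mul_ones_tr.
move=> /(congr1 mxtrace); rewrite !mxtrace_scalar !mulr1n -/(bil R x y) => <-.
rewrite mulr_sum; apply: eq_bigr => k _; rewrite mxE.
by congr (x _ _ * y _ _); rewrite ord1.
Qed.

(** The sum satisfies sigma = a sigma^2 + (1 - a), of which 1 is always a
    root. *)
Lemma solution_sum (K : realType) n (R : 'M[K]_(n, n * n)) (v x : 'cV[K]_n) a :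
  (ones n)^T *m R = (ones (n * n))^T -> \sum_i v i 0 = 1 ->
  is_solution R v a x ->
  let sigma := \sum_i x i 0 in (sigma - 1) * (a * (sigma + 1) - 1) = 0.
Proof.
move=> Rsum v1 x_sol sigma.
have : sigma = a * (sigma * sigma) + (1 - a).
  rewrite -(sum_bil _ _ Rsum) -[1 - a]mulr1 -[X in _ + _ * X]v1 !mulr_sumr -big_split /=.
  by apply: eq_bigr => i _; rewrite {1}x_sol mxE [X in X + _]mxE [X in _ + X]mxE.
by move=> sigmaE; lra.
Qed.

(** The spurious root (1 - a) / a of the equation for the entry sum is less than
    1 when a > 1/2, hence excluded near s. *)
Lemma near_stochastic (K : realType) n (R : 'M[K]_(n, n * n))
    (v s : 'cV[K]_n) (alpha : K) :
  (ones n)^T *m R = (ones (n * n))^T -> stochastic v ->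
  1 / 2 < alpha -> mx_positive s -> stochastic s ->
  \forall ax \near (alpha, s),
    is_solution R v ax.1 ax.2 -> stochastic ax.2.
Proof.
move=> Rsum /stochasticP[_ v1] alpha2 s0 /stochasticP[_ s1].
have coord i : (fun ax : K * 'cV[K]_n => ax.2 i 0) @ (alpha, s) --> s i 0.
  apply: (@cvg_comp _ _ _ snd (fun x : 'cV[K]_n => x i 0) _ (nbhs s)).
    exact: cvg_snd.
  exact: coord_continuous.
have sum_cvg : (fun ax : K * 'cV[K]_n => \sum_i ax.2 i 0) @ (alpha, s) --> (1 : K).
  rewrite -s1; apply: cvg_big => [|i _]; last exact: coord.
  exact: add_continuous.
have factor_cvg : (fun ax : K * 'cV[K]_n => ax.1 * (\sum_i ax.2 i 0 + 1) - 1)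
    @ (alpha, s) --> alpha * (1 + 1) - 1.
  apply: cvgB; last exact: cvg_cst.
  by apply: cvgM; [exact: cvg_fst|apply: cvgD => //; exact: cvg_cst].
have pos : \forall ax \near (alpha, s), forall i, 0 < (ax.2 : 'cV[K]_n) i 0.
  exact: (filter_forall _ (fun i => cvgr_gt _ (coord i) 0 (s0 i 0))).
have factor_gt0 : \forall ax \near (alpha, s),
    0 < ax.1 * (\sum_i (ax.2 : 'cV[K]_n) i 0 + 1) - 1.
  by apply: (cvgr_gt _ factor_cvg); move: alpha2; lra.
apply: filterS2 pos factor_gt0 => -[a x] /= x_gt0 a_gt0 x_sol.
apply/stochasticP; split; first by move=> i j; rewrite (ord1 j) ltW.
have := solution_sum Rsum v1 x_sol => /= /eqP.
rewrite mulf_eq0 => /orP[|/eqP factor0]; first by rewrite subr_eq0 => /eqP.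
by move: a_gt0; rewrite factor0 ltxx.
Qed.

(** * The expansion *)

Theorem lemma10 (K : realType) (n : nat) (alpha : K) (v : 'cV[K]_n)
    (R : 'M[K]_(n, n * n)) (m s : 'cV[K]_n)
    (n_ge1 : (1 <= n)%N)
    (alpha_range : 1 / 2 < alpha < 1)
    (v_stochastic : stochastic v)
    (R_nonneg : mx_nonneg R)
    (R_colsum : (ones n)^T *m R = (ones (n * n))^T)
    (m_minimal : is_minimal_nonneg_solution R v alpha m)
    (m_positive : mx_positive m)
    (Gm_irreducible : mx_irreducible (Gprime R alpha m))
    (s_solution : is_solution R v alpha s)
    (s_stochastic : stochastic s)
    (Gs_nonsingular : 1%:M - Gprime R alpha s \in unitmx) :
  exists shat : K -> 'cV[K]_n,
    (\forall a \near alpha, is_solution R v a (shat a) /\ stochastic (shat a)) /\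
    shat = (fun a : K => s + (a - alpha) *: expansion_coef1 R v alpha s
              + (1 / 2 * (a - alpha) ^+ 2) *: expansion_coef2 R v alpha s)
           +O_ alpha (fun a : K => (a - alpha) ^+ 3).
Proof.
have [alpha_gt _] := andP alpha_range.
have s_positive : mx_positive s.
  have [_ _ m_le] := m_minimal; have [s_nonneg _] := s_stochastic.
  by move=> i j; exact: lt_le_trans (m_le _ s_solution s_nonneg i j).
have [r r0 branch] := solution_branch s_solution Gs_nonsingular.
pose P a x := is_solution R v a x /\
  `|x - taylor2 R v alpha s a| <= r * `|(a - alpha) ^+ 3|.
(* Away from alpha there may be no such solution; the default s is immaterial. *)
pose shat a := xget s (P a).
have shatP : \forall a \near alpha, P a (shat a).
  apply: filterS branch => a [x x_sol x_close].
  by apply: (@xgetPex _ s (P a)); exists x.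
have h_cvg : (fun a : K => a - alpha) @ alpha --> (0 : K).
  by rewrite -(subrr alpha); apply: cvgB; [exact: cvg_id|exact: cvg_cst].
have hX_cvg k : (fun a : K => (a - alpha) ^+ k.+1) @ alpha --> (0 : K).
  have := cvg_comp _ _ h_cvg (@exprn_continuous K k.+1 0).
  by rewrite expr0n; apply.
have taylor_cvg : taylor2 R v alpha s @ alpha --> s.
  have -> : nbhs s = nbhs (s + 0 *: expansion_coef1 R v alpha s
      + (1 / 2 * 0) *: expansion_coef2 R v alpha s).
    by rewrite mulr0 !scale0r !addr0.
  apply: cvgD; first by apply: cvgD; [exact: cvg_cst|exact: cvgZr_tmp].
  apply: cvgZr_tmp; apply: cvgM; [exact: cvg_cst|exact: hX_cvg].
have shat_cvg : shat @ alpha --> s.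
  have diff_cvg : (fun a => shat a - taylor2 R v alpha s a) @ alpha --> 0.
    apply/norm_cvg0P.
    apply: (@squeeze_cvgr _ _ _ _ (fun=> 0) (fun a => r * `|(a - alpha) ^+ 3|)).
    - by apply: filterS shatP => a [_ ->]; rewrite normr_ge0.
    - exact: cvg_cst.
    - rewrite -[X in _ --> X](mulr0 r); apply: cvgM; first exact: cvg_cst.
      exact: (iffRL (norm_cvg0P _) (hX_cvg 2)).
  have -> : shat = (fun a => shat a - taylor2 R v alpha s a)
      \+ taylor2 R v alpha s by apply/funext => a /=; rewrite subrK.
  by rewrite -[X in _ --> X]add0r; exact: cvgD diff_cvg taylor_cvg.
exists shat; split.
  have stoch := near_stochastic R_colsum v_stochastic alpha_gt s_positive
    s_stochastic.
  have pair_cvg : (fun a => (a, shat a)) @ alpha --> (alpha, s).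
    exact: (cvg_pair (@cvg_id _ (nbhs alpha)) shat_cvg).
  have := pair_cvg _ stoch.
  apply: filterS2 shatP => a [x_sol _] /= ax; split => //; exact: ax.
apply/eqaddOP; near=> k; apply: filterS shatP => a [_ close] /=.
by rewrite (le_trans close)// ler_wpM2r.
Unshelve. all: by end_near. Qed.
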